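(* Let $n\ge 1$. If $Q:C[0,1]\to C[0,1]$ is an operator such that $B_nf=(\bar{\mathbb{B}}_n\circ Q)f$ for all $f\in C[0,1]$, then $Q=F_n$. For $n\ge 2$ the operator $F_n$ is not positive; consequently, for $n\ge 2$ there is no positive operator $Q:C[0,1]\to C[0,1]$ with $B_n=\bar{\mathbb{B}}_n\circ Q$.
   Context: $C[0,1]$ is the space of real-valued continuous functions on $[0,1]$; $\Pi_n$ is the space of polynomials of degree at most $n$. An operator is positive if it maps nonnegative functions to nonnegative functions (on $[0,1]$). The Bernstein operator is $B_n(f;x)=\sum_{k=0}^n f(k/n)\binom nk x^k(1-x)^{n-k}$. The genuine Beta operator $\bar{\mathbb{B}}_n:C[0,1]\to C[0,1]$ is defined by $\bar{\mathbb{B}}_n(f;0)=f(0)$, $\bar{\mathbb{B}}_n(f;1)=f(1)$, and for $x\in(0,1)$ $$\bar{\mathbb{B}}_n(f;x)=\frac{1}{B(nx,n(1-x))}\int_0^1 t^{nx-1}(1-t)^{n(1-x)-1}f(t)\,dt,$$ where $B(\cdot,\cdot)$ is the Euler Beta function. $\bar{\mathbb{B}}_n$ restricts to a bijection $\Pi_n\to\Pi_n$, with inverse $\bar{\mathbb{B}}_n^{-1}:\Pi_n\to\Pi_n$, and $F_n:=\bar{\mathbb{B}}_n^{-1}\circ B_n:C[0,1]\to\Pi_n$. *)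

(* Defs.v *)
From HB Require Import structures.
From mathcomp Require Import all_boot all_order all_algebra.
From mathcomp Require Import all_classical all_reals all_analysis.

Set Implicit Arguments.
Unset Strict Implicit.
Unset Printing Implicit Defensive.

Import Order.TTheory GRing.Theory Num.Theory.
Import numFieldNormedType.Exports.

Local Open Scope classical_set_scope.
Local Open Scope ring_scope.

Definition I01 (R : realType) := set_type `[0 : R, 1 : R]%classic.

Definition C01 (R : realType) := continuousType (I01 R) R.

(* [valL_ 0 f : R -> R] extends [f] by 0 outside [0, 1]; for 0 < n the nodes
   k / n lie in [0, 1], so the value outside is never used. *)
Definition bernstein (R : realType) (n : nat) (f : C01 R) : I01 R -> R :=
  fun x => \sum_(k < n.+1)
    valL_ 0 f (k%:R / n%:R) * 'C(n, k)%:R * val x ^+ k * (1 - val x) ^+ (n - k).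

(* The library's [beta_fun] only takes natural numbers as arguments. *)
Definition euler_beta (R : realType) (a b : R) : R :=
  \int[lebesgue_measure]_(t in `[0, 1]) (t `^ (a - 1) * (1 - t) `^ (b - 1)).

(* At the end points 0 `^ p is 0 or 1, which does not affect the integrals. *)
Definition genuine_beta (R : realType) (n : nat) (f : C01 R) : I01 R -> R :=
  fun x =>
    if (val x == 0) || (val x == 1) then f x
    else (euler_beta (n%:R * val x) (n%:R * (1 - val x)))^-1 *
         \int[lebesgue_measure]_(t in `[0, 1])
           (t `^ (n%:R * val x - 1) * (1 - t) `^ (n%:R * (1 - val x) - 1)
            * valL_ 0 f t).

Definition Pi_ (R : realType) (n : nat) : set (C01 R) :=
  [set f : C01 R | exists p : {poly R},
     (size p <= n.+1)%N /\ forall x : I01 R, f x = p.[val x]].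

(* [pinv_ _ A g] is the inverse of the restriction of [g] to [A]. The Beta
   operator maps the polynomials of degree at most n bijectively onto
   themselves and [bernstein n f] is such a polynomial, so the default value
   [cst 0] is never used. *)
Definition F_ (R : realType) (n : nat) (f : C01 R) : C01 R :=
  pinv_ (fun=> cst 0 : C01 R) (@Pi_ R n) (@genuine_beta R n)
    (@bernstein R n f).

(* Operators are arbitrary maps: linearity is not part of the notion. *)
Definition positive_operator (R : realType) (Q : C01 R -> C01 R) : Prop :=
  forall f : C01 R, (forall x, 0 <= f x) -> forall x, 0 <= Q f x.

(* Main.v *)
(** Uniqueness of Q amounts to injectivity of the Beta operator on all of C[0,1].
    With u = ln (t / (1 - t)) and x = 1/2 + s/n the Beta operator integrates f
    against t^(n/2-1) (1-t)^(n/2-1) e^(s u), so if it kills f then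
    h = t^(n/2-1) (1-t)^(n/2-1) f has the two-sided Laplace transform 0 on
    |s| < n/2 in the variable u.  Differentiating in s, all the moments of h in
    u vanish.  Expanding sinc (y (u - u(c))), an entire function of exponential
    type y, in powers of u - u(c) shows that multiplication by it preserves the
    vanishing of all moments, hence h is orthogonal to every power of
    sinc (y (u - u(c))).  Since sinc is 1 at 0 and bounded by some rho < 1 away
    from 0, high even powers concentrate at c and force h(c) = 0.

    The Beta operator maps t^k to prod_(i < k) (n x + i) / (n + i), which has
    degree k; this gives surjectivity on polynomials of degree at most n.
    Evaluating these products at 0 and -1/n shows that p = F_n f satisfies
    p(0) = q(0) and p'(0) = n (q(0) - q(-1/n)) with q = B_n f.  If f is a hat
    function at the node 2/n then q is a positive multiple of x^2 (1-x)^(n-2),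
    so p(0) = 0 and p'(0) < 0, and p is negative near 0. *)

Require Import Defs.
From mathcomp Require Import all_boot all_order all_algebra.
From mathcomp Require Import all_classical all_reals all_analysis.
From mathcomp Require Import measurable_realfun ring lra.

Set Implicit Arguments.
Unset Strict Implicit.
Unset Printing Implicit Defensive.

Import Order.TTheory GRing.Theory Num.Theory.
Import numFieldNormedType.Exports.

Local Open Scope classical_set_scope.
Local Open Scope ring_scope.

(** * The function sinc: power series, and size near and away from 0 *)

Section Sinc.
Context {R : realType}.
Implicit Types (x e rho : R) (N : nat).

Definition sinc x := if x == 0 then 1 else sin x / x.

Definition sinc_sum N x :=
  \sum_(0 <= j < N) (-1) ^+ j * x ^+ j.*2 / (j.*2.+1)`!%:R.

Lemma cvg_sinc_sum x : sinc_sum ^~ x @ \oo --> sinc x.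
Proof.
rewrite /sinc; case: eqVneq => [->|x0].
  apply/cvgrPdist_lt => e e0; near=> n.
  rewrite /sinc_sum -[n]prednK; last by near: n; exact: nbhs_infty_gt.
  rewrite big_nat_recl// big1 ?addr0.
    have -> : (0.*2.+1)`!%:R = 1 :> R by [].
    by rewrite !expr0 mulr1 divr1 subrr normr0.
  by move=> i _; rewrite doubleS expr0n/= mulr0 mul0r.
rewrite (_ : sinc_sum ^~ x = (fun N => series (sin_coeff' x) N * x^-1)).
  by apply: cvgMl; exact: cvg_sin_coeff'.
apply/funext => N; rewrite /sinc_sum /series/= big_distrl/=.
apply: eq_bigr => j _; rewrite /sin_coeff' exprS -!exprnP.
by field; rewrite x0 /= pnatr_eq0 -lt0n fact_gt0.
Unshelve. all: by end_near. Qed.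

(** Since [(2j)! <= (2j+1)!], the terms are dominated by the even terms of the exponential series. A
    majorant uniform in [N] is what dominated convergence requires in [moments_sinc]. *)
Lemma norm_sinc_sum_le N x : `|sinc_sum N x| <= expR `|x|.
Proof.
apply: (@le_trans _ _ (series (exp_coeff `|x|) N.*2)); last first.
  apply: nondecreasing_cvgn_le; last exact: is_cvg_series_exp_coeff.
  by apply: nondecreasing_series => n _ _; exact: exp_coeff_ge0.
elim: N => [|N ih]; first by rewrite /sinc_sum /series/= !big_geq// normr0.
rewrite /sinc_sum big_nat_recr//= (le_trans (ler_normD _ _))//.
rewrite /series/= doubleS !big_nat_recr//= -addrA lerD//.
rewrite -[leLHS]addr0 lerD ?exp_coeff_ge0//.
rewrite !normrM normrX normrN1 expr1n mul1r normrX ler_wpM2l ?exprn_ge0//.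
rewrite ger0_norm// lef_pV2 ?posrE ?ltr0n ?fact_gt0// ler_nat.
by rewrite factS leq_pmull.
Qed.

Lemma sincN x : sinc (- x) = sinc x.
Proof. by rewrite /sinc oppr_eq0 sinN invrN mulrNN. Qed.

Lemma sinc_norm x : sinc `|x| = sinc x.
Proof. by have [] := ger0P x => // _; rewrite sincN. Qed.

Lemma sin_mean_value x : 0 < x -> exists2 c, 0 < c < x & sin x = x * cos c.
Proof.
move=> x0; have [|c] := @MVT R sin cos 0 x x0 (fun y _ => is_derive_sin y).
  by apply: continuous_subspaceT => y; exact: continuous_sin.
by rewrite in_itv/= sin0 !subr0 => cx ->; exists c => //; rewrite mulrC.
Qed.

Lemma norm_sinc_le1 x : `|sinc x| <= 1.
Proof.
rewrite -sinc_norm /sinc; case: eqVneq => [_|x0]; first by rewrite normr1.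
have {}x0 : 0 < `|x| by rewrite lt_def x0 normr_ge0.
have [c _ ->] := sin_mean_value x0.
by rewrite mulrAC divff ?gt_eqF// mul1r cos_max.
Qed.

(** By the mean value theorem [sinc x = cos c] for some [0 < c < |x|], and cos decreases on
    [[0, pi]], which contains [[0, 2]]. *)
Lemma cos_le_sinc x : `|x| <= 2 -> cos x <= sinc x.
Proof.
rewrite -sinc_norm -cos_norm /sinc; case: eqVneq => [->|x0]; first by rewrite cos0.
have {}x0 : 0 < `|x| by rewrite lt_def x0 normr_ge0.
have [c /andP[c0 cx] ->] := sin_mean_value x0 => x2.
rewrite mulrAC divff ?gt_eqF// mul1r.
have pi2 := pi_ge2 R.
apply/ltW; rewrite ltr_cos ?in_itv/=//; apply/andP; split; lra.
Qed.

Lemma sinc_near0 rho : rho < 1 -> exists2 r, 0 < r &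
  forall x, `|x| < r -> rho < sinc x.
Proof.
move=> r1; have /cvgrPdist_lt := @continuous_cos R 0.
rewrite cos0 => /(_ (1 - rho)); rewrite subr_gt0 => /(_ r1) [r /= r0 hr].
exists (Num.min r 2); first by rewrite lt_min r0/=.
move=> x; rewrite lt_min => /andP[xr x2].
have := cos_le_sinc (ltW x2).
have := hr x; rewrite /= sub0r normrN => /(_ xr).
rewrite ltr_distlC => /andP[]; lra.
Qed.

(** For [y >= 2] the bound [|sin y| <= 1] gives 1/2. For smaller [y] the half-angle formula and the
    mean value theorem at [y / 2] give [|sinc y| <= cos (y / 2)], which is at most
    [cos (f / 2) < 1]. *)
Lemma sinc_away0 e : 0 < e -> exists2 rho, 0 < rho < 1 &
  forall x, e <= `|x| -> `|sinc x| <= rho.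
Proof.
move=> e0; pose f := Num.min e 2.
have f0 : 0 < f by rewrite lt_min e0/=.
have f2 : f <= 2 by rewrite ge_min lexx orbT.
have pi2 := pi_ge2 R.
have cf1 : cos (f / 2) < 1.
  rewrite -[ltRHS]cos0 ltr_cos ?in_itv/= ?lexx ?pi_ge0//; first by lra.
  by apply/andP; split; lra.
(* One bound for each of the ranges [y >= 2] and [f <= y < 2]. *)
exists (Num.max 2^-1 (cos (f / 2))).
  by rewrite lt_max gt_max cf1 andbT invr_gt0 ltr0n/=; lra.
move=> x ex; rewrite -sinc_norm; set y := `|x|.
have fy : f <= y by rewrite (le_trans _ ex)// ge_min lexx.
have y0 : 0 < y by lra.
rewrite /sinc gt_eqF// normrM normfV (gtr0_norm y0) ler_pdivrMr//.
suff : `|sin y| <= 2^-1 * y \/ `|sin y| <= cos (f / 2) * y.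
  by case => /le_trans; apply; rewrite ler_wpM2r ?(ltW y0)// le_max lexx ?orbT.
have [y2|y2] := leP 2 y.
  by left; have := sin_max y; lra.
right; have hy : 0 < y / 2 by lra.
have [c _ sE] := sin_mean_value hy.
have -> : sin y = 2 * (cos (y / 2) * sin (y / 2)).
  have := sin_mulr2n (y / 2); rewrite mulr_natl => <-.
  by congr sin; rewrite -mulr_natl; field.
have cy : 0 <= cos (y / 2).
  by apply: cos_ge0_pihalf; apply/andP; split; lra.
have cf : cos (y / 2) <= cos (f / 2).
  have [->//|nyf] := eqVneq y f.
  apply/ltW; rewrite ltr_cos ?in_itv/=.
  - have : f < y by rewrite lt_def nyf.
    lra.
  - by apply/andP; split; lra.
  - by apply/andP; split; lra.
have -> : `|2 * (cos (y / 2) * sin (y / 2))| = cos (y / 2) * `|cos c| * y.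
  rewrite sE !normrM (ger0_norm cy) (gtr0_norm y0) normfV normr_nat.
  by field.
rewrite ler_wpM2r ?(ltW y0)//.
by rewrite (le_trans _ cf)// ler_piMr// cos_max.
Qed.

End Sinc.

Lemma measurable_sinc (R : realType) : measurable_fun [set: R] (@sinc R).
Proof.
apply: (@measurable_fun_cvg _ _ _ _ (fun N => sinc_sum N)) => [N|x _].
- apply: measurable_sum => j; apply: measurable_funM => //.
  by apply: measurable_funM => //; exact: measurable_funX.
- exact: cvg_sinc_sum.
Qed.

(** * Two-sided Laplace transforms in a variable [u], their derivatives and moments *)

Section ExponentialMoments.
Context d (T : measurableType d) (R : realType).
Variables (mu : {measure set T -> \bar R}) (D : set T).
Hypothesis mD : measurable D.

Lemma Rintegral_dominated_cvg (f_ : nat -> T -> R) (f g : T -> R) :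
  (forall n, mu.-integrable D (EFin \o f_ n)) -> measurable_fun D f ->
  (forall x, D x -> f_ ^~ x @ \oo --> f x) ->
  mu.-integrable D (EFin \o g) ->
  (forall n x, D x -> `|f_ n x| <= g x) ->
  \int[mu]_(x in D) f_ n x @[n --> \oo] --> \int[mu]_(x in D) f x.
Proof.
move=> if_ mf f_f ig f_g.
have [|||||intf _ cvg_int] := @dominated_convergence _ _ _ mu D mD
  (fun n => EFin \o f_ n) (EFin \o f) (EFin \o g).
- by move=> n; exact: measurable_int (if_ n).
- exact/measurable_EFinP.
- apply: aeW => x Dx; apply: cvg_EFin; first exact: nearW.
  exact: f_f.
- exact: ig.
- by apply: aeW => x n Dx /=; rewrite lee_fin; exact: f_g.
apply: fine_cvg; rewrite fineK//; exact: integrable_fin_num.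
Qed.

Lemma Rintegral_dominated_eq0 (f_ : nat -> T -> R) (f g : T -> R) :
  (forall n, mu.-integrable D (EFin \o f_ n)) -> measurable_fun D f ->
  (forall x, D x -> f_ ^~ x @ \oo --> f x) ->
  mu.-integrable D (EFin \o g) ->
  (forall n x, D x -> `|f_ n x| <= g x) ->
  (forall n, \int[mu]_(x in D) f_ n x = 0) ->
  \int[mu]_(x in D) f x = 0.
Proof.
move=> if_ mf f_f ig f_g f_0.
have := Rintegral_dominated_cvg if_ mf f_f ig f_g.
under eq_fun do rewrite f_0.
by move=> /cvg_lim <- //; rewrite lim_cst.
Qed.

Lemma integrable_finD (f g : T -> R) : mu.-integrable D (EFin \o f) ->
  mu.-integrable D (EFin \o g) -> mu.-integrable D (EFin \o (fun x => f x + g x)).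
Proof. by move=> hf hg; exact: (integrableD mD hf hg). Qed.

Lemma integrable_finB (f g : T -> R) : mu.-integrable D (EFin \o f) ->
  mu.-integrable D (EFin \o g) -> mu.-integrable D (EFin \o (fun x => f x - g x)).
Proof. by move=> hf hg; exact: (integrableB mD hf hg). Qed.

Lemma integrable_finZl (r : R) (f : T -> R) : mu.-integrable D (EFin \o f) ->
  mu.-integrable D (EFin \o (fun x => r * f x)).
Proof. by move=> hf; exact: (integrableZl mD r hf). Qed.

Lemma le_integrable_fin (f g : T -> R) : measurable_fun D f ->
  (forall x, D x -> `|f x| <= g x) ->
  mu.-integrable D (EFin \o g) -> mu.-integrable D (EFin \o f).
Proof.
move=> mf fg; apply: le_integrable => //; first exact/measurable_EFinP.
move=> x Dx /=; rewrite lee_fin (le_trans (fg x Dx))//; exact: ler_norm.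
Qed.

Variables (u : T -> R) (delta : R).
Hypothesis mu_u : measurable_fun D u.

(** Absolute convergence of the two-sided Laplace transform of [h] in the variable [u], for real
    parameters in a neighbourhood of 0. *)
Definition exp_integrable (h : T -> R) := measurable_fun D h /\
  forall s, `|s| < delta ->
  mu.-integrable D (EFin \o (fun t => h t * expR (s * u t))).

Lemma measurable_expRu s : measurable_fun D (fun t => expR (s * u t)).
Proof.
apply: measurableT_comp => //; exact: measurable_funM.
Qed.

Lemma le_exp_integrable (h g : T -> R) : measurable_fun D h ->
  (forall x, D x -> `|h x| <= `|g x|) -> exp_integrable g -> exp_integrable h.
Proof.
move=> mh hg [mg ig]; split=> // s sd.
apply: (@le_integrable_fin _ (fun t => `|g t * expR (s * u t)|)).
- by apply: measurable_funM => //; exact: measurable_expRu.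
- move=> x Dx; rewrite !normrM ler_wpM2r//; exact: hg.
- exact: (integrable_norm (ig s sd)).
Qed.

Lemma expR_norm_le (x : R) : expR `|x| <= expR x + expR (- x).
Proof.
have [x0|x0] := ger0P x; first by rewrite lerDl expR_ge0.
by rewrite lerDr expR_ge0.
Qed.

(** The factor [expR (e * |u|)] is at most [expR (e * u) + expR (- e * u)], and [s + e] and [s - e]
    both stay within the range of convergence. This provides the dominating functions used below. *)
Lemma exp_integrable_abs (h : T -> R) s e : exp_integrable h ->
  `|s| + e < delta -> 0 <= e ->
  mu.-integrable D (EFin \o (fun t => `|h t| * (expR (s * u t) * expR (e * `|u t|)))).
Proof.
move=> [mh ih] se e0.
have i1 : `|s + e| < delta.
  by rewrite (le_lt_trans (ler_normD _ _))// (ger0_norm e0).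
have i2 : `|s - e| < delta.
  by rewrite (le_lt_trans (ler_normB _ _))// (ger0_norm e0).
apply: (@le_integrable_fin _
  (fun t => `|h t * expR ((s + e) * u t)| + `|h t * expR ((s - e) * u t)|)).
- apply: measurable_funM; first exact: measurableT_comp.
  apply: measurable_funM; first exact: measurable_expRu.
  apply: measurableT_comp => //; apply: measurable_funM => //.
  exact: measurableT_comp.
- move=> x Dx; rewrite !normrM normr_id !(ger0_norm (expR_ge0 _)).
  rewrite -mulrDr ler_wpM2l// !mulrDl !expRD -mulrDr ler_wpM2l ?expR_ge0//.
  by rewrite mulNr -{1}(ger0_norm e0) -normrM expR_norm_le.
- by apply: integrable_finD; apply: integrable_norm; exact: ih.
Qed.

Lemma norm_le_expR (e x : R) : 0 < e -> `|x| <= e^-1 * expR (e * `|x|).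
Proof.
move=> e0; rewrite ler_pdivlMl//.
by have := expR_ge1Dx (e * `|x|); apply: le_trans; rewrite lerDr.
Qed.

(** The factor [|u|] is at most [e^-1 * expR (e * |u|)], and the gap between [|s|] and [delta]
    leaves room for such an [e]. *)
Lemma exp_integrableM (h : T -> R) : exp_integrable h ->
  exp_integrable (fun t => h t * u t).
Proof.
move=> hh; have [mh ih] := hh; split; first exact: measurable_funM.
move=> s sd; pose e := (delta - `|s|) / 2.
have e0 : 0 < e by rewrite divr_gt0// subr_gt0.
have se : `|s| + e < delta by rewrite /e; lra.
apply: (@le_integrable_fin _
  (fun t => e^-1 * (`|h t| * (expR (s * u t) * expR (e * `|u t|))))).
- apply: measurable_funM; first exact: measurable_funM.
  exact: measurable_expRu.
- move=> x Dx; rewrite !normrM (ger0_norm (expR_ge0 _)).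
  rewrite mulrCA -mulrA ler_wpM2l// mulrCA mulrC ler_wpM2l ?expR_ge0//.
  exact: norm_le_expR.
- by apply: integrable_finZl; apply: exp_integrable_abs => //; exact: ltW.
Qed.

Lemma exp_integrableMX (h : T -> R) k : exp_integrable h ->
  exp_integrable (fun t => h t * u t ^+ k).
Proof.
move=> hh; elim: k => [|k ih].
  by under eq_fun do rewrite expr0 mulr1.
by under eq_fun do rewrite exprSr mulrA; exact: exp_integrableM.
Qed.

Definition exp_annihilated (h : T -> R) := forall s, `|s| < delta ->
  \int[mu]_(t in D) (h t * expR (s * u t)) = 0.

(** With [x = ee n * u] this bounds the difference quotient [(expR (ee n * u) - 1) / ee n] by
    [|u| * expR (e * |u|)], uniformly in [n]. *)
Lemma norm_expRB1_le (x : R) : `|expR x - 1| <= `|x| * expR `|x|.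
Proof.
have [x0|x0] := ger0P x.
  have := expR_ge1Dx (- x).
  rewrite ger0_norm; last by rewrite subr_ge0 -expR0 ler_expR.
  have e0 := expR_gt0 x; rewrite expRN => h.
  have : expR x * (1 - x) <= expR x * (expR x)^-1 by rewrite ler_pM2l.
  rewrite divff ?gt_eqF//; nra.
have := expR_ge1Dx x.
have h1 : expR x <= 1 by rewrite -expR0 ler_expR ltW.
rewrite ler0_norm ?subr_le0// => h.
have : 1 <= expR (- x) by rewrite -expR0 ler_expR oppr_ge0 ltW.
nra.
Qed.

Lemma cvg_expR_quotient (e x : R) : 0 < e ->
  (expR (e / n.+1%:R * x) - 1) / (e / n.+1%:R) @[n --> \oo] --> x.
Proof.
move=> e0.
have : is_derive (0 : R) 1 (fun y => expR (y * x)) x.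
  have : is_derive (0 : R) 1 (fun y : R => y * x) x.
    rewrite (_ : (fun y : R => y * x) = @idfun R * cst x)//.
    by apply: is_derive_eq; rewrite scaler0 add0r /cst /GRing.scale/= mulr1.
  by move=> h; apply: is_derive_eq; rewrite mul0r expR0 mul1r.
move=> [/[swap] dE /cvg_ex[l hl]].
have lx : l = x by rewrite -dE; apply/esym/cvg_lim.
rewrite lx in hl => {lx dE l}.
move/cvgr_dnbhsP : hl => /(_ (fun n => e / n.+1%:R)).
have -> : (fun n : nat => (expR (e / n.+1%:R * x) - 1) / (e / n.+1%:R)) =
  (fun n => (e / n.+1%:R)^-1 *: (((fun y => expR (y * x)) \o shift 0)
     ((e / n.+1%:R) *: 1) - expR (0 * x))).
  apply/funext => n /=; rewrite /GRing.scale/= mulr1 addr0 mul0r expR0.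
  by rewrite mulrC.
apply; split; first by move=> n; rewrite gt_eqF// divr_gt0.
rewrite -[X in _ --> X](mulr0 e); apply: cvgMr; exact: cvg_harmonic.
Qed.

(** Differentiation under the integral sign: the integral is the limit of difference quotients of
    the transform at [s], and these all vanish because [s + ee n] stays in the range where the
    transform is 0. *)
Lemma exp_annihilatedM (h : T -> R) : exp_integrable h -> exp_annihilated h ->
  exp_annihilated (fun t => h t * u t).
Proof.
move=> hh h0 s sd; pose e := (delta - `|s|) / 2.
have [mh ih] := hh.
have e0 : 0 < e by rewrite divr_gt0// subr_gt0.
have se : `|s| + e < delta by rewrite /e; lra.
pose ee n : R := e / n.+1%:R.
have ee0 n : 0 < ee n by rewrite divr_gt0.
have eee n : ee n <= e.
  by rewrite ler_pdivrMr// ler_peMr ?ler1n// ltW.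
have sen n : `|s + ee n| < delta.
  rewrite (le_lt_trans _ se)// (le_trans (ler_normD _ _))//.
  by rewrite lerD2l gtr0_norm.
have qE n : (fun t => h t * expR (s * u t) * ((expR (ee n * u t) - 1) / ee n)) =
  (fun t => (ee n)^-1 * (h t * expR ((s + ee n) * u t) - h t * expR (s * u t))).
  by apply/funext => t; rewrite (mulrDl s) expRD; ring.
have iq n : mu.-integrable D (EFin \o
    (fun t => h t * expR ((s + ee n) * u t) - h t * expR (s * u t))).
  by apply: integrable_finB; exact: ih.
apply: (@Rintegral_dominated_eq0 (fun n t => h t * expR (s * u t) *
    ((expR (ee n * u t) - 1) / ee n)) _
    (fun t => `|h t * u t| * (expR (s * u t) * expR (e * `|u t|)))).
- move=> n; rewrite qE.
  exact: integrable_finZl.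
- by apply: measurable_funM; [exact: measurable_funM|exact: measurable_expRu].
- move=> x Dx /=; rewrite mulrAC; apply: cvgMr; exact: cvg_expR_quotient.
- by apply: exp_integrable_abs => //; [exact: exp_integrableM|exact: ltW].
- move=> n x Dx; rewrite !normrM (ger0_norm (expR_ge0 _)).
  rewrite [leRHS]mulrACA.
  rewrite ler_wpM2l ?mulr_ge0 ?expR_ge0//.
  rewrite normfV (gtr0_norm (ee0 n)) ler_pdivrMr//.
  rewrite (le_trans (norm_expRB1_le _))// normrM (gtr0_norm (ee0 n)).
  rewrite -mulrA mulrC ler_wpM2r ?(ltW (ee0 n))// ler_wpM2l// ler_expR.
  by rewrite ler_wpM2r.
- move=> n; rewrite qE RintegralZl// RintegralB//; last 2 first.
    exact: ih.
    exact: ih.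
  by rewrite !h0// subrr mulr0.
Qed.

Lemma exp_annihilated_moments (h : T -> R) : 0 < delta -> exp_integrable h ->
  exp_annihilated h -> forall k, \int[mu]_(t in D) (h t * u t ^+ k) = 0.
Proof.
move=> d0 hh h0 k.
suff hk : exp_annihilated (fun t => h t * u t ^+ k).
  have := hk 0; rewrite normr0 => /(_ d0) <-.
  by apply: eq_Rintegral => t _; rewrite mul0r expR0 mulr1.
elim: k => [|k ih]; first by under eq_fun do rewrite expr0 mulr1.
under eq_fun do rewrite exprSr mulrA.
by apply: exp_annihilatedM => //; exact: exp_integrableMX.
Qed.

(** The partial sums of sinc are polynomials in [u], so their integrals against [h * u ^+ k] vanish.
    The majorant [|h * u ^+ k| * expR (|y| * |u|)] is integrable as [|y| < delta], and dominated
    convergence applies. *)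
Lemma moments_sinc (h : T -> R) y : exp_integrable h -> `|y| < delta ->
  (forall k, \int[mu]_(t in D) (h t * u t ^+ k) = 0) ->
  forall k, \int[mu]_(t in D) (h t * sinc (y * u t) * u t ^+ k) = 0.
Proof.
move=> hh yd h0 k.
have d0 : 0 < delta by exact: le_lt_trans yd.
have i0 j : mu.-integrable D (EFin \o (fun t => h t * u t ^+ j)).
  have := (exp_integrableMX j hh).2 0; rewrite normr0 => /(_ d0).
  by under eq_fun do rewrite mul0r expR0 mulr1.
have SE N : (fun t => h t * sinc_sum N.+1 (y * u t) * u t ^+ k) =
  (fun t => h t * sinc_sum N (y * u t) * u t ^+ k +
    (-1) ^+ N * y ^+ N.*2 / (N.*2.+1)`!%:R * (h t * u t ^+ (N.*2 + k))).
  apply/funext => t; rewrite /sinc_sum big_nat_recr//= exprMn exprD; ring.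
have iS N : mu.-integrable D
    (EFin \o (fun t => h t * sinc_sum N (y * u t) * u t ^+ k)).
  elim: N => [|N ih].
    under eq_fun do rewrite /sinc_sum big_geq// mulr0 mul0r.
    exact: integrable0.
  by rewrite SE; apply: integrable_finD => //; exact: integrable_finZl.
apply: (@Rintegral_dominated_eq0
    (fun N t => h t * sinc_sum N (y * u t) * u t ^+ k) _
    (fun t => `|h t * u t ^+ k| * (expR (0 * u t) * expR (`|y| * `|u t|)))) => //.
- apply: measurable_funM; last exact: measurable_funX.
  apply: measurable_funM; first exact: hh.1.
  by apply: (measurableT_comp (@measurable_sinc R)); exact: measurable_funM.
- move=> t Dt; apply: cvgMl; apply: cvgMr; exact: cvg_sinc_sum.
- apply: exp_integrable_abs; first exact: exp_integrableMX.
    by rewrite normr0 add0r.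
  exact: normr_ge0.
- move=> N t Dt; rewrite mulrAC normrM ler_wpM2l// mul0r expR0 mul1r -normrM.
  exact: norm_sinc_sum_le.
- elim=> [|N ih].
    under eq_Rintegral do rewrite /sinc_sum big_geq// mulr0 mul0r.
    by rewrite Rintegral_cst// mul0r.
  rewrite SE RintegralD//; last exact: integrable_finZl.
  by rewrite ih add0r RintegralZl// h0 mulr0.
Qed.

Lemma moments_sincX (h : T -> R) y N : exp_integrable h -> `|y| < delta ->
  (forall k, \int[mu]_(t in D) (h t * u t ^+ k) = 0) ->
  \int[mu]_(t in D) (h t * sinc (y * u t) ^+ N) = 0.
Proof.
move=> hh yd h0.
(* Both properties are carried through the induction: each new factor sinc needs all moments of the
   previous product, and integrability survives since [|sinc| <= 1]. *)
suff [_ /(_ 0)] : exp_integrable (fun t => h t * sinc (y * u t) ^+ N) /\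
    forall k, \int[mu]_(t in D) (h t * sinc (y * u t) ^+ N * u t ^+ k) = 0.
  by move=> <-; apply: eq_Rintegral => t _; rewrite expr0 mulr1.
elim: N => [|N [ih1 ih2]].
  split; first by under eq_fun do rewrite expr0 mulr1.
  by move=> k; rewrite -(h0 k); apply: eq_Rintegral => t _; rewrite expr0 mulr1.
split; last first.
  move=> k; rewrite -[RHS](moments_sinc ih1 yd ih2 k).
  by apply: eq_Rintegral => t _; rewrite exprSr mulrA.
under eq_fun do rewrite exprSr mulrA.
apply: le_exp_integrable (ih1).
- apply: measurable_funM; first exact: ih1.1.
  by apply: (measurableT_comp (@measurable_sinc R)); exact: measurable_funM.
- by move=> t Dt; rewrite normrM ler_piMr// norm_sinc_le1.
Qed.

End ExponentialMoments.

(** * Uniqueness of the Laplace transform in the logit coordinate *)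

Section LogitUniqueness.
Context {R : realType}.
Notation mu := (@lebesgue_measure R).
Implicit Types (s t c : R).

(** The coordinate in which moving Beta parameters from [(a, b)] to [(a + s, b - s)] multiplies the
    weight by an exponential; see [beta_weight_shift]. *)
Definition logit t : R := ln t - ln (1 - t).

Lemma measurable_logit : measurable_fun [set: R] logit.
Proof.
apply: measurable_funB; first exact: measurable_ln.
by apply: (measurableT_comp (@measurable_ln R)); exact: measurable_funB.
Qed.

Lemma ltr_logit : {in `]0, 1[ &, {homo logit : x y / x < y}}.
Proof.
move=> x y; rewrite !in_itv/= => /andP[x0 x1] /andP[y0 y1] xy.
have : ln x < ln y by rewrite ltr_ln ?posrE.
have : ln (1 - y) < ln (1 - x) by rewrite ltr_ln ?posrE ?subr_gt0// ltrD2l ltrN2.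
rewrite /logit; lra.
Qed.

Lemma continuous_logit : {in `]0, 1[, continuous logit}.
Proof.
move=> x; rewrite in_itv/= => /andP[x0 x1].
apply: cvgB; first exact: continuous_ln.
apply: (@continuous_comp _ _ _ (fun t => 1 - t) (@ln R)).
  by apply: cvgB; [exact: cvg_cst|exact: cvg_id].
by apply: continuous_ln; rewrite subr_gt0.
Qed.

(** If [h c > 0], even powers of [sinc (y * u)] peak at [c]: the mass near [c] is at least a
    constant times [rho' ^+ N.*2], while the negative part is at most a constant times [rho ^+ N.*2]
    with [rho < rho']. For large [N] the integral cannot be 0. *)
Lemma laplace_logit_le0 (h : R -> R) (delta c : R) : 0 < delta ->
  {in `]0, 1[, continuous h} ->
  (forall s, `|s| < delta ->
     mu.-integrable `]0, 1[ (EFin \o (fun t => h t * expR (s * logit t)))) ->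
  (forall s, `|s| < delta ->
     \int[mu]_(t in `]0, 1[) (h t * expR (s * logit t)) = 0) ->
  0 < c < 1 -> h c <= 0.
Proof.
move=> d0 ch ih h0 /andP[c0 c1]; rewrite leNgt; apply/negP => hc.
pose D := (`]0, 1[ : set R)%classic.
have mD : measurable D by exact: measurable_itv.
(* Centring at [c] only multiplies the transform by the constant [expR (- (s * logit c))], so both
   hypotheses pass to [u]. *)
pose u t := logit t - logit c.
have mu_u : measurable_fun D u.
  apply: measurable_funB => //; apply: measurable_funTS.
  exact: measurable_logit.
have mh : measurable_fun D h.
  apply: open_continuous_measurable_fun; first exact: interval_open.
  by move=> x; rewrite inE; exact: ch.
have uE s : (fun t => h t * expR (s * u t)) =
  (fun t => expR (- (s * logit c)) * (h t * expR (s * logit t))).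
  by apply/funext => t; rewrite mulrBr expRD; ring.
have hh : exp_integrable mu D u delta h.
  split=> // s sd; rewrite uE; apply: integrable_finZl => //; exact: ih.
have ha : exp_annihilated mu D u delta h.
  move=> s sd; rewrite uE RintegralZl//; last exact: ih.
  by rewrite h0// mulr0.
have h_moments :=
  @exp_annihilated_moments _ _ _ mu D mD u delta mu_u h d0 hh ha.
pose y := delta / 2.
have y0 : 0 < y by rewrite divr_gt0.
have yd : `|y| < delta by rewrite gtr0_norm// /y; lra.
have h_sinc N :=
  @moments_sincX _ _ _ mu D mD u delta mu_u h y N hh yd h_moments.
pose eta := h c / 2.
have eta0 : 0 < eta by rewrite divr_gt0.
have [r [r0 rc r1 hr]] : exists r, [/\ 0 < r, r <= c, r <= 1 - c &
    forall t, `|c - t| < r -> eta < h t].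
  have /cvgrPdist_lt/(_ _ eta0)[r /= r0 hr] : h @ c --> h c.
    by apply: ch; rewrite in_itv/= c0.
  exists (Num.min r (Num.min c (1 - c))); split.
  - by rewrite !lt_min r0 c0 subr_gt0.
  - by rewrite !ge_min lexx orbT.
  - by rewrite !ge_min lexx !orbT.
  - move=> t; rewrite lt_min => /andP[tr _].
    have := hr t tr; rewrite ltr_distlC => /andP[+ _].
    by rewrite /eta; lra.
(* As [r] may equal [c] or [1 - c], it is halved: [c - r / 2] and [c + r / 2] lie strictly inside
   the interval, and monotonicity of [logit] bounds [|u|] from below beyond them. *)
have [u0 u00 hu0] : exists2 u0, 0 < u0 &
    forall t, D t -> r / 2 <= `|c - t| -> u0 <= `|u t|.
  have l1 : logit (c - r / 2) < logit c.
    by apply: ltr_logit; rewrite ?in_itv/=; try (apply/andP; split); lra.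
  have l2 : logit c < logit (c + r / 2).
    by apply: ltr_logit; rewrite ?in_itv/=; try (apply/andP; split); lra.
  exists (Num.min (logit c - logit (c - r / 2)) (logit (c + r / 2) - logit c)).
    by rewrite lt_min !subr_gt0 l1.
  move=> t; rewrite /D/= in_itv/= => /andP[t0 t1]; rewrite ge_min.
  have [ct|ct] := leP c t.
    rewrite ler0_norm ?subr_le0// => ctr; apply/orP; right.
    rewrite ler_normr; apply/orP; left; rewrite lerD2r.
    have [<-//|ne] := eqVneq (c + r / 2) t.
    apply/ltW/ltr_logit; rewrite ?in_itv/= ?t0 ?t1//; last first.
      by rewrite lt_def eq_sym ne/=; lra.
    by apply/andP; split; lra.
  rewrite gtr0_norm ?subr_gt0// => ctr; apply/orP; left.
  rewrite ler_normr; apply/orP; right; rewrite (opprB (logit t)) lerD2l lerN2.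
  have [->//|ne] := eqVneq t (c - r / 2).
  apply/ltW/ltr_logit; rewrite ?in_itv/= ?t0 ?t1//; last first.
    by rewrite lt_def eq_sym ne/=; lra.
  by apply/andP; split; lra.
have [rho /andP[rho0 rho1] hrho] := sinc_away0 (mulr_gt0 y0 u00).
(* A level strictly between [rho] and 1: sinc exceeds it near [c], and the ratio [rho / rho'] is
   below 1. *)
pose rho' := (1 + rho) / 2.
have rho'1 : rho' < 1 by rewrite /rho'; lra.
have rhorho' : rho < rho' by rewrite /rho'; lra.
have [r2 r20 hr2] := sinc_near0 rho'1.
have [r3 [r30 r3r hr3]] : exists r3, [/\ 0 < r3, r3 <= r / 2 &
    forall t, `|c - t| < r3 -> rho' < sinc (y * u t)].
  have /cvgrPdist_lt/(_ (r2 / y)) : logit @ c --> logit c.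
    by apply: continuous_logit; rewrite in_itv/= c0.
  rewrite divr_gt0// => /(_ isT)[r3 /= r30 hr3].
  exists (Num.min r3 (r / 2)); split.
  - by rewrite lt_min r30 divr_gt0.
  - by rewrite ge_min lexx orbT.
  - move=> t; rewrite lt_min => /andP[tr _]; apply: hr2.
    by rewrite normrM (gtr0_norm y0) mulrC -ltr_pdivlMr// distrC hr3.
pose I := (`]c - r3, c + r3[ : set R)%classic.
have ID : I `<=` D.
  move=> t; rewrite /I/D/= !in_itv/= => /andP[h1 h2]; apply/andP; split; lra.
have mI : measurable I by exact: measurable_itv.
have muI : mu I = (2 * r3)%:E.
  rewrite /I lebesgue_measure_itv/= lte_fin ifT; last by lra.
  by rewrite -EFinD; congr EFin; lra.
have i_h : mu.-integrable D (EFin \o h).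
  have := ih 0; rewrite normr0 => /(_ d0).
  rewrite (_ : (fun t => h t * expR (0 * logit t)) = h)//.
  by apply/funext => t; rewrite mul0r expR0 mulr1.
have i_I : mu.-integrable D (EFin \o \1_I).
  apply/integrableP; split.
    by apply/measurable_EFinP; exact: measurable_indic.
  under eq_integral do rewrite gee0_abs ?lee_fin//.
  rewrite integral_indic// setIidl//.
  by apply: (le_lt_trans (_ : _ <= (2 * r3)%:E)%E); rewrite ?ltry// -muI.
have JE : \int[mu]_(t in D) \1_I t = 2 * r3.
  by rewrite /Rintegral integral_indic// setIidl//; exact: (congr1 fine muI).
pose W := \int[mu]_(t in D) `|h t|.
(* The difference of the two sides is the integral of [rho' ^+ N.*2 * eta * \1_I - rho ^+ N.*2 *
   |h|]. It suffices to bound this integrand pointwise by [h * sinc (y * u) ^+ N.*2], whose integral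
   is 0. *)
have key N : rho' ^+ N.*2 * (eta * (2 * r3)) <= rho ^+ N.*2 * W.
  rewrite -subr_le0 -JE -(h_sinc N.*2) mulrA -RintegralZl// -RintegralZl//; last first.
    exact: integrable_norm.
  rewrite -RintegralB//; last 2 first.
    exact: integrable_finZl.
    by apply: integrable_finZl => //; exact: integrable_norm.
  apply: le_Rintegral => //.
  - apply: integrable_finB => //; first exact: integrable_finZl.
    by apply: integrable_finZl => //; exact: integrable_norm.
  - apply: (@le_integrable_fin _ _ _ mu D mD _ (fun t => `|h t|)).
    + apply: measurable_funM => //; apply: measurable_funX.
      by apply: (measurableT_comp (@measurable_sinc R)); exact: measurable_funM.
    + by move=> t Dt; rewrite normrM normrX ler_piMr// exprn_ile1// norm_sinc_le1.
    + exact: integrable_norm.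
  move=> t Dt; have [tr3|tr3] := ltP `|c - t| r3.
    have tI : t \in I.
      by rewrite inE /I/= in_itv/=; move: tr3; rewrite ltr_distlC.
    rewrite indicE tI mulr1.
    have hs := hr3 t tr3; have ht : eta < h t by apply: hr; lra.
    have hS : rho' ^+ N.*2 <= sinc (y * u t) ^+ N.*2.
      by rewrite lerXn2r ?nnegrE//; lra.
    have rr : 0 <= rho' ^+ N.*2 by rewrite exprn_ge0//; lra.
    have : 0 <= rho ^+ N.*2 * `|h t| by rewrite mulr_ge0// exprn_ge0// ltW.
    have : rho' ^+ N.*2 * eta <= h t * sinc (y * u t) ^+ N.*2.
      by rewrite mulrC ler_pM// ltW.
    lra.
  have tI : (t \in I) = false.
    apply/negbTE; rewrite notin_setE /I/= in_itv/= => /andP[h1 h2].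
    by move: tr3; rewrite leNgt ltr_distlC h1 h2.
  rewrite indicE tI mulr0 sub0r.
  have rr : 0 <= rho ^+ N.*2 * `|h t| by rewrite mulr_ge0// exprn_ge0// ltW.
  (* Between [r3] and [r] the product [h * sinc ^+ N.*2] is nonnegative, since [h > eta] and the
     power is even; beyond [r], [|sinc| <= rho]. *)
  have [tr|tr] := ltP `|c - t| r.
    have ht : eta < h t by exact: hr.
    rewrite (le_trans (_ : _ <= 0))//; first by rewrite oppr_le0.
    by rewrite mulr_ge0//; [lra|rewrite -mul2n exprM exprn_ge0// sqr_ge0].
  rewrite lerNl (le_trans (ler_norm _))// normrN normrM mulrC ler_wpM2r//.
  rewrite normrX lerXn2r ?nnegrE// ?(ltW rho0)//.
  apply: hrho; rewrite normrM (gtr0_norm y0) ler_wpM2l ?(ltW y0)//.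
  by apply: hu0 => //; lra.
have e0 : 0 < eta * (2 * r3) by rewrite mulr_gt0// mulr_gt0.
have W0 : 0 <= W by apply: Rintegral_ge0.
have rho'0 : 0 < rho' by lra.
pose z := (rho / rho') ^+ 2.
have z1 : `|z| < 1.
  rewrite /z normrX exprn_ilt1// normrM normfV !gtr0_norm// ltr_pdivrMr//.
  by rewrite mul1r.
(* The denominator is [W + 1] because [W] is only known to be nonnegative. *)
have /cvgrPdist_lt/(_ (eta * (2 * r3) / (W + 1))) := cvg_expr z1.
rewrite divr_gt0//; last by lra.
move=> /(_ isT)[N _ /(_ N (leqnn N))]/=.
rewrite sub0r normrN ltr_pdivlMr; last by lra.
have zE : z ^+ N = rho ^+ N.*2 / rho' ^+ N.*2.
  by rewrite /z -exprM mul2n expr_div_n.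
rewrite ger0_norm; last by rewrite zE divr_ge0// exprn_ge0// ltW.
have rN : 0 < rho' ^+ N.*2 by rewrite exprn_gt0.
have kN : eta * (2 * r3) <= z ^+ N * W.
  by rewrite zE [leRHS]mulrAC ler_pdivlMr// mulrC; exact: key.
have : 0 <= z ^+ N by rewrite zE divr_ge0// exprn_ge0// ltW.
lra.
Qed.

(* Injectivity of the two-sided Laplace transform on R, transported to ]0, 1[
   along logit to avoid a change of variables. *)
Lemma laplace_logit_inj (h : R -> R) (delta c : R) : 0 < delta ->
  {in `]0, 1[, continuous h} ->
  (forall s, `|s| < delta ->
     mu.-integrable `]0, 1[ (EFin \o (fun t => h t * expR (s * logit t)))) ->
  (forall s, `|s| < delta ->
     \int[mu]_(t in `]0, 1[) (h t * expR (s * logit t)) = 0) ->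
  0 < c < 1 -> h c = 0.
Proof.
move=> d0 ch ih h0 c01; apply/eqP; rewrite eq_le.
rewrite (laplace_logit_le0 d0 ch ih h0 c01)/= -oppr_le0.
have hE s : (fun t => - h t * expR (s * logit t)) =
  (fun t => -1 * (h t * expR (s * logit t))).
  by apply/funext => t; rewrite mulN1r mulNr.
apply: (@laplace_logit_le0 (fun t => - h t) _ _ d0 _ _ _ c01).
- by move=> x x01; apply: cvgN; exact: ch.
- by move=> s sd; rewrite hE; apply: integrable_finZl => //; exact: ih.
- by move=> s sd; rewrite hE RintegralZl ?h0 ?mulr0//; exact: ih.
Qed.

End LogitUniqueness.

(** * Integrals over the open unit interval as limits over compact subintervals *)

Section OpenUnitInterval.
Context {R : realType}.
Notation mu := (@lebesgue_measure R).
Implicit Types (f F : R -> R) (a b x t : R) (i : nat).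

(** Starting at 1/3 makes [eps i < 1 - eps i] strict from the first index on. *)
Definition eps i : R := i.+3%:R^-1.

Definition exhaustion i : set R := `[eps i, 1 - eps i]%classic.

Lemma exhaustion_lt i : 0 < eps i < 1 - eps i.
Proof.
rewrite /eps invr_gt0 ltr0n/= ltrBrDl -mulr2n -[_ *+ 2]mulr_natr mulrC ltr_pdivrMr//.
by rewrite mul1r ltr_nat.
Qed.

Lemma exhaustion_sub i : exhaustion i `<=` `]0, 1[.
Proof.
have /andP[h1 h2] := exhaustion_lt i.
by move=> t; rewrite /exhaustion/= !in_itv/= => /andP[h3 h4]; apply/andP; split; lra.
Qed.

Lemma exhaustion_near t : 0 < t < 1 -> \forall i \near \oo, exhaustion i t.
Proof.
move=> /andP[t0 t1]; have : 0 < Num.min t (1 - t) by rewrite lt_min t0 subr_gt0.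
move=> m0; have /cvgrPdist_lt/(_ _ m0) := @cvg_harmonic R.
case=> N _ hN; exists N => // n Nn.
have := hN n Nn; rewrite /= sub0r normrN ger0_norm//.
rewrite lt_min => /andP[n1 n2].
have : eps n <= n.+1%:R^-1.
  by rewrite /eps lef_pV2 ?posrE// ler_nat -addn2 leq_addr.
rewrite /exhaustion/= in_itv/= => n3; rewrite (le_trans n3 (ltW n1))/=.
by rewrite lerBrDl -lerBrDr (le_trans n3 (ltW n2)).
Qed.

Lemma Rintegral_exhaustion_cvg f : mu.-integrable `]0, 1[ (EFin \o f) ->
  \int[mu]_(t in exhaustion i) f t @[i --> \oo] -->
  \int[mu]_(t in `]0, 1[) f t.
Proof.
move=> i_f; have mf := measurable_int _ i_f.
have mE i : measurable (exhaustion i) by exact: measurable_itv.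
have -> : (fun i => \int[mu]_(t in exhaustion i) f t) =
    (fun i => \int[mu]_(t in `]0, 1[) (f \_ (exhaustion i)) t).
  apply/funext => i; rewrite -Rintegral_mkcondr setIidr//.
  exact: exhaustion_sub.
have mfR : measurable_fun (`]0, 1[ : set R)%classic f by exact/measurable_EFinP.
have mfE i : measurable_fun (`]0, 1[ : set R)%classic (f \_ (exhaustion i)).
  apply/(measurable_restrict f (mE i) (measurable_itv _)).
  by apply: measurable_funS mfR; [exact: measurable_itv|exact: subIsetl].
have le_f i t : `|(f \_ (exhaustion i)) t| <= `|f t|.
  by rewrite /patch; case: ifPn; rewrite ?normr0.
apply: (@Rintegral_dominated_cvg _ _ _ mu _ (measurable_itv _) _ f
  (fun t => `|f t|)) => //.
- move=> i; apply: (@le_integrable_fin _ _ _ mu _ (measurable_itv _) _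
    (fun t => `|f t|)) => //; first exact: mfE.
  exact: integrable_norm.
- move=> t; rewrite /= in_itv/= => t01.
  apply/cvgrPdist_lt => e e0; near=> i.
  rewrite patchE mem_set ?subrr ?normr0//.
  by near: i; exact: exhaustion_near.
- exact: integrable_norm.
Unshelve. all: by end_near. Qed.

Lemma integral_exhaustion f F i : {in `]0, 1[, continuous f} ->
  (forall x, 0 < x < 1 -> is_derive x 1 F (f x)) ->
  (\int[mu]_(t in exhaustion i) (f t)%:E =
    (F (1 - eps i))%:E - (F (eps i))%:E)%E.
Proof.
move=> cf dF; have /andP[h1 h2] := exhaustion_lt i.
have dFi x : x \in `[eps i, 1 - eps i] -> is_derive x 1 F (f x).
  rewrite in_itv/= => /andP[h3 h4].
  by apply: dF; apply/andP; split; lra.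
have cF : {within `[eps i, 1 - eps i], continuous F}.
  by apply: derivable_within_continuous => x /dFi[].
apply: continuous_FTC2 => //.
- apply: continuous_in_subspaceT => x; rewrite inE => /exhaustion_sub h.
  exact: cf.
- have [cF1 cF2 cF3] := (continuous_within_itvP _ h2).1 cF.
  split => // x xi; have [|] := dFi x => //.
  exact: subset_itv_oo_cc xi.
- move=> x xi; rewrite derive1E; apply: derive_val.
  apply: dFi; exact: subset_itv_oo_cc xi.
Qed.

(** Over each compact subinterval the integral is a difference of two values of [F], hence at most
    [2 * M]; monotone convergence passes this bound to the whole interval. *)
Lemma ge0_FTC_integrable f F (M : R) : {in `]0, 1[, continuous f} ->
  (forall x, 0 < x < 1 -> 0 <= f x) ->
  (forall x, 0 < x < 1 -> is_derive x 1 F (f x)) ->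
  (forall x, 0 < x < 1 -> `|F x| <= M) ->
  mu.-integrable `]0, 1[ (EFin \o f).
Proof.
move=> cf f0 dF FM.
have mf : measurable_fun (`]0, 1[ : set R)%classic f.
  apply: open_continuous_measurable_fun; first exact: interval_open.
  by move=> x; rewrite inE; exact: cf.
have bigE : \bigcup_i exhaustion i = `]0, 1[%classic.
  apply/seteqP; split=> [t [i _ /exhaustion_sub]//|t].
  rewrite /= in_itv/= => /exhaustion_near[N _ hN].
  by exists N => //; apply: hN => /=.
apply/integrableP; split; first exact/measurable_EFinP.
under eq_integral.
  move=> t; rewrite inE/= in_itv/= => t01.
  rewrite ger0_norm ?f0//.
  over.
rewrite -bigE.
apply: (@le_lt_trans _ _ (M + M)%:E); last exact: ltry.
have cvgi : (\int[mu]_(t in exhaustion i) (f t)%:E)%E @[i --> \oo] -->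
    (\int[mu]_(t in \bigcup_i exhaustion i) (f t)%:E)%E.
  apply: ge0_nondecreasing_set_cvg_integral.
  - apply/nondecreasing_seqP => i; rewrite subsetEset.
    have h : eps i.+1 <= eps i by rewrite /eps lef_pV2 ?posrE// ler_nat.
    by apply: subset_itv; rewrite bnd_simp; lra.
  - by move=> i; exact: measurable_itv.
  - move=> i; apply/measurable_EFinP; apply: measurable_funS mf => //.
    exact: exhaustion_sub.
  - move=> i t /exhaustion_sub; rewrite /= in_itv/= => t01.
    by rewrite lee_fin f0.
apply: (cvge_le _ cvgi); apply: nearW => i.
rewrite (integral_exhaustion i cf dF) -EFinB lee_fin.
rewrite (le_trans (ler_norm _))// (le_trans (ler_normB _ _))//.
have /andP[h1 h2] := exhaustion_lt i.
by apply: lerD; apply: FM; apply/andP; split; lra.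
Qed.

(** This form of the fundamental theorem needs only the limits of [F] at the end points, where [f]
    may be singular. It serves for integration by parts with vanishing boundary terms. *)
Lemma FTC_Rintegral0 f F : {in `]0, 1[, continuous f} ->
  mu.-integrable `]0, 1[ (EFin \o f) ->
  (forall x, 0 < x < 1 -> is_derive x 1 F (f x)) ->
  F (eps i) @[i --> \oo] --> 0 ->
  F (1 - eps i) @[i --> \oo] --> 0 ->
  \int[mu]_(t in `]0, 1[) f t = 0.
Proof.
move=> cf i_f dF F0 F1; apply: cvg_unique (Rintegral_exhaustion_cvg i_f) _ => //.
have -> : (fun i => \int[mu]_(t in exhaustion i) f t) =
    (fun i => F (1 - eps i) - F (eps i)).
  by apply/funext => i; rewrite /Rintegral (integral_exhaustion i cf dF).
by have := cvgB F1 F0; rewrite subrr; apply.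
Qed.

End OpenUnitInterval.

(** * The Beta integral with real parameters: convergence, recurrence, positivity *)

Section BetaWeight.
Context {R : realType}.
Notation mu := (@lebesgue_measure R).
Implicit Types (a b x t : R) (f : R -> R).

Definition beta_weight a b t : R := t `^ (a - 1) * (1 - t) `^ (b - 1).

Lemma is_derive_powR_onem b t : t < 1 ->
  is_derive t 1 (fun y : R => (1 - y) `^ b) (- (b * (1 - t) `^ (b - 1))).
Proof.
move=> t1; have d1 : is_derive t 1 (fun y : R => 1 - y) (-1).
  by apply: is_derive_eq; rewrite add0r mul1r.
have p1 : 0 < 1 - t by rewrite subr_gt0.
have d2 : is_derive (1 - t) 1 (fun y : R => y `^ b) (b * (1 - t) `^ (b - 1)).
  exact: is_derive1_powR.
have := @is_derive1_comp R (fun y : R => y `^ b) (fun y : R => 1 - y) t _ _ d2 d1.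
by rewrite mulrN1.
Qed.

Lemma continuous_powR_gt0 a t : 0 < t ->
  {for t, continuous (fun y : R => y `^ a)}.
Proof.
move=> t0; apply: differentiable_continuous; apply/derivable1_diffP.
by have [] := is_derive1_powR a t0.
Qed.

Lemma continuous_powR_onem b t : t < 1 ->
  {for t, continuous (fun y : R => (1 - y) `^ b)}.
Proof.
move=> t1; apply: differentiable_continuous; apply/derivable1_diffP.
by have [] := is_derive_powR_onem b t1.
Qed.

Lemma continuous_beta_weight a b : {in `]0, 1[, continuous (beta_weight a b)}.
Proof.
move=> t; rewrite in_itv/= => /andP[t0 t1].
by apply: (@cvgM _ _ _ _ (fun y : R => y `^ (a - 1))
    (fun y : R => (1 - y) `^ (b - 1)));
  [exact: continuous_powR_gt0|exact: continuous_powR_onem].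
Qed.

Lemma beta_weight_gt0 a b t : 0 < t < 1 -> 0 < beta_weight a b t.
Proof. by move=> /andP[t0 t1]; rewrite mulr_gt0// powR_gt0// subr_gt0. Qed.

Lemma powR_le1 a t : 0 <= a -> 0 < t < 1 -> t `^ a <= 1.
Proof.
move=> a0 /andP[t0 t1]; have := @ge0_ler_powR R a a0 t 1.
by rewrite !nnegrE powR1; apply => //; exact: ltW.
Qed.

(** This is multiplication by [1 = t + (1 - t)]. In each summand one exponent has become positive,
    so its power is at most 1 and only one end point singularity remains. *)
Lemma beta_weight_split a b t : 0 < a -> 0 < b -> 0 < t < 1 ->
  beta_weight a b t = beta_weight (a + 1) b t + beta_weight a (b + 1) t.
Proof.
move=> a0 b0 /andP[t0 t1]; have t1' : 0 < 1 - t by rewrite subr_gt0.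
rewrite /beta_weight !addrK -(mulr_powRB1 (ltW t0) a0).
by rewrite -(mulr_powRB1 (ltW t1') b0); ring.
Qed.

Lemma integrable_powR a : 0 < a ->
  mu.-integrable `]0, 1[ (EFin \o (fun t => t `^ (a - 1))).
Proof.
move=> a0; apply: (@ge0_FTC_integrable _ _ (fun t => a^-1 * t `^ a) a^-1).
- move=> t; rewrite in_itv/= => /andP[t0 t1].
  exact: continuous_powR_gt0.
- by move=> t _; exact: powR_ge0.
- move=> t /andP[t0 t1]; have d := is_derive1_powR a t0.
  rewrite (_ : (fun y => _) = a^-1 *: (fun y : R => y `^ a))//.
  by apply: is_derive_eq; rewrite /GRing.scale/= mulrA mulVf ?gt_eqF// mul1r.
- move=> t t01; rewrite ger0_norm ?mulr_ge0 ?invr_ge0 ?powR_ge0 ?(ltW a0)//.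
  by rewrite ler_piMr ?invr_ge0 ?(ltW a0)// powR_le1// ltW.
Qed.

Lemma integrable_powR_onem b : 0 < b ->
  mu.-integrable `]0, 1[ (EFin \o (fun t => (1 - t) `^ (b - 1))).
Proof.
move=> b0; apply: (@ge0_FTC_integrable _ _ (fun t => - b^-1 * (1 - t) `^ b) b^-1).
- move=> t; rewrite in_itv/= => /andP[t0 t1].
  exact: continuous_powR_onem.
- by move=> t _; exact: powR_ge0.
- move=> t /andP[t0 t1]; have d := is_derive_powR_onem b t1.
  rewrite (_ : (fun y => _) = (- b^-1) *: (fun y : R => (1 - y) `^ b))//.
  by apply: is_derive_eq; rewrite /GRing.scale/= mulrNN mulrA mulVf ?gt_eqF// mul1r.
- move=> t /andP[t0 t1]; rewrite normrM normrN !ger0_norm ?invr_ge0 ?powR_ge0 ?(ltW b0)//.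
  rewrite ler_piMr ?invr_ge0 ?(ltW b0)// powR_le1// ?(ltW b0)//.
  by apply/andP; split; lra.
Qed.

Lemma measurable_beta_weight a b :
  measurable_fun (`]0, 1[ : set R)%classic (beta_weight a b).
Proof.
apply: open_continuous_measurable_fun; first exact: interval_open.
by move=> x; rewrite inE; exact: continuous_beta_weight.
Qed.

Lemma integrable_beta_weight a b : 0 < a -> 0 < b ->
  mu.-integrable `]0, 1[ (EFin \o beta_weight a b).
Proof.
move=> a0 b0; apply: (@le_integrable_fin _ _ _ mu _ (measurable_itv _) _
    (fun t => (1 - t) `^ (b - 1) + t `^ (a - 1))).
- exact: measurable_beta_weight.
- move=> t; rewrite /= in_itv/= => t01; have /andP[t0 t1] := t01.
  rewrite ger0_norm; last by rewrite ltW// beta_weight_gt0.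
  rewrite (beta_weight_split a0 b0 t01) /beta_weight !addrK.
  apply: lerD.
    by rewrite ler_piMl ?powR_ge0// powR_le1// ltW.
  rewrite ler_piMr ?powR_ge0// powR_le1// ?ltW//.
  by rewrite subr_gt0 ltrBlDr ltrDl t0 t1.
- by apply: integrable_finD; [exact: measurable_itv|exact: integrable_powR_onem|
    exact: integrable_powR].
Qed.

Definition beta_int a b : R := \int[mu]_(t in `]0, 1[) beta_weight a b t.

(** Integrating the derivative of [t^a (1 - t)^b], which vanishes at both ends, gives
    [a B(a, b+1) = b B(a+1, b)]; combine with [B(a, b) = B(a+1, b) + B(a, b+1)]. *)
Lemma beta_int_recl a b : 0 < a -> 0 < b ->
  beta_int (a + 1) b = a / (a + b) * beta_int a b.
Proof.
move=> a0 b0.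
have a10 : 0 < a + 1 by rewrite addr_gt0.
have b10 : 0 < b + 1 by rewrite addr_gt0.
have i1 := integrable_beta_weight a0 b10.
have i2 := integrable_beta_weight a10 b0.
have splitE : beta_int a b = beta_int (a + 1) b + beta_int a (b + 1).
  rewrite /beta_int -RintegralD//.
  by apply: eq_Rintegral => t; rewrite inE/= in_itv/=; exact: beta_weight_split.
have eps0 : @eps R @ \oo --> 0.
  have := @cvg_harmonic R; rewrite -(cvg_shiftn 2).
  by apply: cvg_trans; apply: near_eq_cvg; apply: nearW => n; rewrite /eps/= addn2.
have epspowR c : 0 < c -> eps i `^ c @[i --> \oo] --> (0 : R).
  move=> c0; have /cvg_at_rightP := powR_cvg0 c0; apply; split => // i.
  by have /andP[] := @exhaustion_lt R i.
have parts : \int[mu]_(t in `]0, 1[)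
    (a * beta_weight a (b + 1) t - b * beta_weight (a + 1) b t) = 0.
  apply: (@FTC_Rintegral0 _ _ (fun t => t `^ a * (1 - t) `^ b)).
  - move=> t t01; apply: cvgB; apply: cvgMr; exact: continuous_beta_weight.
  - by apply: integrable_finB; [exact: measurable_itv|exact: integrable_finZl|
      exact: integrable_finZl].
  - move=> t /andP[t0 t1]; have d1 := is_derive1_powR a t0.
    have d2 := is_derive_powR_onem b t1.
    rewrite (_ : (fun y => _) = (fun y : R => y `^ a) * (fun y : R => (1 - y) `^ b))//.
    apply: is_derive_eq; rewrite /GRing.scale/= /beta_weight !addrK; ring.
  - apply: (@squeeze_cvgr _ _ _ _ (cst 0) (fun i => eps i `^ a)).
    + apply: nearW => i; have /andP[e0 e1] := @exhaustion_lt R i.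
      rewrite /cst mulr_ge0 ?powR_ge0//= ler_piMr ?powR_ge0//.
      by apply: powR_le1; [exact: ltW|apply/andP; split; lra].
    + exact: cvg_cst.
    + exact: epspowR.
  - apply: (@squeeze_cvgr _ _ _ _ (cst 0) (fun i => eps i `^ b)).
    + apply: nearW => i; have /andP[e0 e1] := @exhaustion_lt R i.
      rewrite /cst subKr mulr_ge0 ?powR_ge0//= ler_piMl ?powR_ge0//.
      by apply: powR_le1; [exact: ltW|apply/andP; split; lra].
    + exact: cvg_cst.
    + exact: epspowR.
move: parts; rewrite RintegralB//; last 2 first.
  by apply: integrable_finZl.
  by apply: integrable_finZl.
rewrite !RintegralZl// -!/(beta_int _ _) => h.
have ab : a + b != 0 by rewrite gt_eqF// addr_gt0.
apply: (mulfI ab); rewrite mulrA mulrCA divff// mulr1.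
by rewrite splitE; lra.
Qed.

(** On [[1/3, 2/3]] the weight has a positive lower bound. The comparison
    [t^(a-1) >= t^a >= (1/3)^a] avoids a case distinction on the sign of [a - 1]. *)
Lemma beta_int_gt0 a b : 0 < a -> 0 < b -> 0 < beta_int a b.
Proof.
move=> a0 b0; have i1 := integrable_beta_weight a0 b0.
have /andP[e0 e1] := @exhaustion_lt R 0.
pose E : set R := exhaustion 0.
pose c := eps 0 `^ a * eps 0 `^ b : R.
have c0 : 0 < c by rewrite mulr_gt0// powR_gt0.
have lec t : E t -> c <= beta_weight a b t.
  move=> Et; have /= := exhaustion_sub Et; rewrite in_itv/= => /andP[t0 t1].
  move: Et; rewrite /E/exhaustion/= in_itv/= => /andP[te t1e].
  have t1' : 0 < 1 - t by rewrite subr_gt0.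
  rewrite /c /beta_weight; apply: ler_pM; rewrite ?powR_ge0//.
    apply: (@le_trans _ _ (t `^ a)).
      by apply: ge0_ler_powR; rewrite ?nnegrE//; lra.
    by rewrite -mulr_powRB1 ?(ltW t0)// ler_piMl ?powR_ge0// ltW.
  apply: (@le_trans _ _ ((1 - t) `^ b)).
    by apply: ge0_ler_powR; rewrite ?nnegrE//; lra.
  by rewrite -mulr_powRB1 ?(ltW t1')// ler_piMl ?powR_ge0//; lra.
have mE : measurable E by exact: measurable_itv.
suff : ((c * (1 - eps 0 - eps 0))%:E <= (beta_int a b)%:E)%E.
  by rewrite lee_fin; apply: lt_le_trans; rewrite mulr_gt0//; lra.
have -> : (beta_int a b)%:E = (\int[mu]_(t in `]0%R, 1%R[) (beta_weight a b t)%:E)%E.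
  by rewrite /beta_int /Rintegral fineK//; exact: integrable_fin_num.
have mw := measurable_beta_weight a b.
have -> : (c * (1 - eps 0 - eps 0))%:E = (\int[mu]_(t in E) c%:E)%E.
  rewrite integral_cst//= /E /exhaustion lebesgue_measure_itv/= lte_fin e1.
  by rewrite -EFinD -EFinM.
apply: (@le_trans _ _ (\int[mu]_(t in E) (beta_weight a b t)%:E)%E).
  apply: ge0_le_integral => //.
  - by move=> t Et; rewrite lee_fin ltW.
  - apply/measurable_EFinP; apply: measurable_funS mw => //.
    exact: exhaustion_sub.
apply: ge0_subset_integral => //.
- exact/measurable_EFinP.
- by move=> t; rewrite /= in_itv/= => t01; rewrite lee_fin ltW// beta_weight_gt0.
- exact: exhaustion_sub.
Qed.

End BetaWeight.

(** * Continuous functions on [0, 1] and the Beta operator at interior points *)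

Section ContinuousOnUnitInterval.
Context {R : realType}.
Notation mu := (@lebesgue_measure R).
Implicit Types (f g : C01 R) (x : I01 R) (t : R).

Lemma val_I01 x : 0 <= val x <= 1.
Proof. by have := set_valP x; rewrite /= in_itv. Qed.

Lemma valL_val f x : valL_ 0 f (val x) = f x.
Proof. exact: (congr1 (fun h => h x) (valLK (0 : R) (f : I01 R -> R))). Qed.

Lemma within_continuous_valL f : {within `[0, 1], continuous (valL_ 0 f)}.
Proof. by apply/subspace_sigL_continuousP; rewrite valLK; exact: cts_fun. Qed.

Lemma continuous_valL f : {in `]0, 1[, continuous (valL_ 0 f)}.
Proof.
by have [] := (continuous_within_itvP _ (@ltr01 R)).1 (@within_continuous_valL f).
Qed.

Lemma valL_bounded f : exists M, forall t, 0 < t < 1 -> `|valL_ 0 f t| <= M.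
Proof.
have /compact_bounded[M [_ hM]] :=
  continuous_compact (@within_continuous_valL f) (@segment_compact R 0 1).
exists (M + 1) => t /andP[t0 t1].
apply: (hM (M + 1)); first by rewrite ltrDl.
by exists t => //; rewrite /= in_itv/= !ltW.
Qed.

Lemma integrable_beta_weightM (a b : R) f : 0 < a -> 0 < b ->
  mu.-integrable `]0, 1[ (EFin \o (fun t => beta_weight a b t * valL_ 0 f t)).
Proof.
move=> a0 b0; have [M hM] := valL_bounded f.
apply: (@le_integrable_fin _ _ _ mu _ (measurable_itv _) _
    (fun t => M * beta_weight a b t)).
- apply: open_continuous_measurable_fun; first exact: interval_open.
  move=> t; rewrite inE => t01; apply: cvgM.
    exact: continuous_beta_weight.
  exact: continuous_valL.
- move=> t; rewrite /= in_itv/= => t01; rewrite normrM mulrC.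
  rewrite (gtr0_norm (beta_weight_gt0 _ _ t01)).
  by rewrite ler_wpM2r ?hM// ltW// beta_weight_gt0.
- by apply: integrable_finZl; [exact: measurable_itv|exact: integrable_beta_weight].
Qed.

Lemma Rintegral_itv_cc_oo (h : R -> R) :
  mu.-integrable `]0, 1[ (EFin \o h) ->
  \int[mu]_(t in `[0, 1]) h t = \int[mu]_(t in `]0, 1[) h t.
Proof.
move=> ih; rewrite /Rintegral integral_itv_bndoo//; exact: measurable_int ih.
Qed.

(** The end points form a null set, so both integrals may be taken over the open interval, where the
    weight is continuous. *)
Lemma genuine_betaE n f x : (0 < n)%N -> 0 < val x < 1 ->
  genuine_beta n f x =
  (beta_int (n%:R * val x) (n%:R * (1 - val x)))^-1 *
  \int[mu]_(t in `]0, 1[)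
    (beta_weight (n%:R * val x) (n%:R * (1 - val x)) t * valL_ 0 f t).
Proof.
move=> n0 /andP[x0 x1]; rewrite /genuine_beta gt_eqF// lt_eqF//=.
have a0 : 0 < n%:R * val x by rewrite mulr_gt0// ltr0n.
have b0 : 0 < n%:R * (1 - val x) by rewrite mulr_gt0// ?subr_gt0// ltr0n.
rewrite /euler_beta (Rintegral_itv_cc_oo (integrable_beta_weight a0 b0)).
by rewrite (Rintegral_itv_cc_oo (integrable_beta_weightM f a0 b0)).
Qed.

Definition mkI01 t (t01 : 0 <= t <= 1) : I01 R :=
  SigSub (mem_set (t01 : `[0, 1]%classic t)).

End ContinuousOnUnitInterval.

(** * Injectivity of the Beta operator on C[0, 1] *)

Section GenuineBetaInjective.
Context {R : realType}.
Notation mu := (@lebesgue_measure R).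
Implicit Types (f g : C01 R) (x : I01 R) (a b s t : R).

(** Because [expR (s * logit t) = t^s (1 - t)^(-s)]. *)
Lemma beta_weight_shift a b s t : 0 < t < 1 ->
  beta_weight a b t * expR (s * logit t) = beta_weight (a + s) (b - s) t.
Proof.
move=> /andP[t0 t1]; rewrite /beta_weight /powR /logit.
rewrite !(gt_eqF t0) gt_eqF ?subr_gt0// -!expRD; congr expR; ring.
Qed.

(* The density t^(n/2 - 1) (1 - t)^(n/2 - 1) (f - g)(t) has vanishing transform
   on |s| < n/2: there s = n (x - 1/2) with x in ]0, 1[. *)
Lemma genuine_beta_inj n f g : (0 < n)%N ->
  genuine_beta n f = genuine_beta n g -> f = g.
Proof.
move=> n0 fg; apply/continuousEP => x.
have [x01|x01] := boolP (0 < val x < 1); last first.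
  (* At an end point the operator is evaluation, so the equality is immediate. *)
  have xE : (val x == 0) || (val x == 1).
    move: x01; have := val_I01 x; rewrite !lt_def => /andP[-> ->].
    by rewrite !andbT negb_and !negbK [1 == _]eq_sym.
  by have := congr1 (fun h => h x) fg; rewrite /genuine_beta xE.
have nR : 0 < n%:R :> R by rewrite ltr0n.
pose c : R := n%:R / 2.
have c0 : 0 < c by rewrite divr_gt0.
pose h t := beta_weight c c t * (valL_ 0 f t - valL_ 0 g t).
have shift s : `|s| < c -> [/\ 0 < c + s, 0 < c - s &
    {in `]0, 1[%classic, (fun t => beta_weight (c + s) (c - s) t * valL_ 0 f t -
      beta_weight (c + s) (c - s) t * valL_ 0 g t) =1
      (fun t => h t * expR (s * logit t))}].
  rewrite ltr_norml => /andP[s1 s2]; split; [lra|lra|].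
  move=> t; rewrite inE/= in_itv/= => t01.
  by rewrite -beta_weight_shift// /h -mulrBr mulrAC.
suff hx : h (val x) = 0.
  rewrite -!valL_val; apply/eqP; rewrite -subr_eq0; apply/eqP.
  apply: (mulfI (negbT (gt_eqF (beta_weight_gt0 c c x01)))).
  by rewrite mulr0; exact: hx.
apply: (@laplace_logit_inj _ h c) => //.
- move=> t t01; apply: cvgM; first exact: continuous_beta_weight.
  by apply: cvgB; exact: continuous_valL.
- move=> s /shift[s1 s2 sE].
  have := @integrable_finB _ _ _ mu _ (measurable_itv _) _ _
    (integrable_beta_weightM f s1 s2) (integrable_beta_weightM g s1 s2).
  apply: eq_integrable; first exact: measurable_itv.
  by move=> t /sE; rewrite /= => ->.
- move=> s /shift[s1 s2 sE].
  have -> : \int[mu]_(t in `]0, 1[) (h t * expR (s * logit t)) =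
      \int[mu]_(t in `]0, 1[) (beta_weight (c + s) (c - s) t * valL_ 0 f t -
        beta_weight (c + s) (c - s) t * valL_ 0 g t).
    by apply: eq_Rintegral => t /sE.
  rewrite RintegralB//; last 2 first.
    exact: integrable_beta_weightM.
    exact: integrable_beta_weightM.
  have y01 : 0 < 2^-1 + s / n%:R < 1.
    have -> : 2^-1 + s / n%:R = (c + s) / n%:R.
      by rewrite /c; field; rewrite gt_eqF.
    by rewrite divr_gt0//= ltr_pdivrMr// /c; move: s1 s2; rewrite /c; lra.
  have y01' : 0 <= 2^-1 + s / n%:R <= 1 by have /andP[y0 y1] := y01; rewrite !ltW.
  have := congr1 (fun h => h (mkI01 y01')) fg.
  rewrite !genuine_betaE//=.
  have -> : n%:R * (2^-1 + s / n%:R) = c + s.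
    by rewrite /c; field; rewrite gt_eqF.
  have -> : n%:R * (1 - (2^-1 + s / n%:R)) = c - s.
    by rewrite /c; field; rewrite gt_eqF.
  have B0 := beta_int_gt0 s1 s2.
  have Bn : (beta_int (c + s) (c - s))^-1 != 0 by rewrite invr_eq0 gt_eqF.
  by move/(mulfI Bn) => ->; rewrite subrr.
Qed.

End GenuineBetaInjective.

(** * Action of the Beta operator on polynomials *)

Section GenuineBetaPolynomials.
Context {R : realType}.
Notation mu := (@lebesgue_measure R).
Implicit Types (p q : {poly R}) (x : I01 R) (a b t : R) (n k m : nat).

Lemma continuous_comp_val (phi : R -> R) : continuous phi ->
  continuous (fun x : I01 R => phi (val x)).
Proof.
move=> cphi x; apply: (@continuous_comp _ _ _ (val : I01 R -> R) phi).
  exact: initial_continuous.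
exact: cphi.
Qed.

Definition restrict_C01 (phi : R -> R) (cphi : continuous phi) : C01 R :=
  mkcts (continuous_comp_val cphi).

Lemma restrict_C01E phi (cphi : continuous phi) x :
  restrict_C01 cphi x = phi (val x).
Proof. by []. Qed.

Definition poly_C01 p : C01 R := restrict_C01 (@continuous_horner R p).

Definition beta_poly n k : {poly R} :=
  \prod_(i < k) ((n + i)%:R^-1 *: (n%:R *: 'X + i%:R%:P)).

(** The Beta operator on polynomials of degree at most [n], as an algebraic map; coefficients beyond
    degree [n] are dropped. *)
Definition beta_transform n p : {poly R} :=
  \sum_(k < n.+1) p`_k *: beta_poly n k.

Lemma horner_beta_poly n k t : (beta_poly n k).[t] =
  \prod_(i < k) ((n%:R * t + i%:R) / (n + i)%:R).
Proof.
rewrite /beta_poly horner_prod; apply: eq_bigr => i _.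
by rewrite !hornerE mulrC.
Qed.

Lemma size_beta_poly n k : (0 < n)%N -> size (beta_poly n k) = k.+1.
Proof.
move=> n0; elim: k => [|k ih]; first by rewrite /beta_poly big_ord0 size_poly1.
have nR : n%:R != 0 :> R by rewrite pnatr_eq0 -lt0n.
have nk : (n + k)%:R != 0 :> R by rewrite pnatr_eq0 addn_eq0 negb_and -lt0n n0.
have fE : (n + k)%:R^-1 *: (n%:R *: 'X + k%:R%:P) =
    ((n + k)%:R^-1 * n%:R) *: ('X - (- (k%:R / n%:R))%:P) :> {poly R}.
  rewrite -scalerA; congr (_ *: _); rewrite scalerBr polyCN scalerN opprK.
  by congr (_ + _); rewrite -[RHS]mul_polyC -polyCM; congr _%:P; field.
rewrite /beta_poly big_ord_recr/= -/(beta_poly n k) fE.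
have cn : (n + k)%:R^-1 * n%:R != 0 :> R by rewrite mulf_neq0// invr_eq0.
rewrite size_mul; first by rewrite ih size_scale// size_XsubC addn2.
- by rewrite -size_poly_eq0 ih.
- by rewrite scaler_eq0 negb_or cn polyXsubC_eq0.
Qed.

Lemma beta_transformD n p q :
  beta_transform n (p + q) = beta_transform n p + beta_transform n q.
Proof.
rewrite /beta_transform -big_split; apply: eq_bigr => k _.
by rewrite coefD scalerDl.
Qed.

Lemma beta_transformZXn n (c : R) k : (k <= n)%N ->
  beta_transform n (c *: 'X^k) = c *: beta_poly n k.
Proof.
move=> kn; have kn' : (k < n.+1)%N by [].
rewrite /beta_transform (bigD1 (Ordinal kn'))//= big1 ?addr0.
  by rewrite coefZ coefXn eqxx mulr1.
move=> i ik; rewrite coefZ coefXn.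
have /negbTE -> : (i : nat) != k by apply: contraNneq ik => ik; exact/eqP/val_inj.
by rewrite mulr0 scale0r.
Qed.

(** The map is triangular in the degree: a multiple of [beta_poly n m], whose coefficient in degree
    [m] is nonzero, removes the top term, and the rest is handled by induction. *)
Lemma beta_transform_surj n q : (0 < n)%N -> (size q <= n.+1)%N ->
  exists2 p : {poly R}, (size p <= n.+1)%N & beta_transform n p = q.
Proof.
move=> n0; suff H m : (m <= n.+1)%N -> forall q, (size q <= m)%N ->
    exists2 p : {poly R}, (size p <= m)%N & beta_transform n p = q by exact: (H n.+1).
elim: m => [_ {}q|m ih mn {}q qm].
  rewrite leqn0 size_poly_eq0 => /eqP ->; exists 0; first by rewrite size_poly0.
  by rewrite /beta_transform big1// => k _; rewrite coef0 scale0r.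
have lc : (beta_poly n m)`_m != 0.
  have := size_beta_poly m n0; rewrite -[_`_m]/(_`_(m.+1.-1)) => {1}<-.
  by rewrite -lead_coefE lead_coef_eq0 -size_poly_eq0 size_beta_poly.
pose c := q`_m / (beta_poly n m)`_m.
have [|p pm pE] := ih (ltnW mn) (q - c *: beta_poly n m).
  apply/leq_sizeP => j mj; rewrite coefB coefZ.
  move: mj; rewrite leq_eqVlt => /predU1P[<-|mj].
    by rewrite /c divfK// subrr.
  by rewrite !nth_default ?mulr0 ?subr0// ?size_beta_poly// (leq_trans qm).
exists (p + c *: 'X^m).
  rewrite (leq_trans (size_polyD _ _))// geq_max (leq_trans pm)//=.
  by rewrite (leq_trans (size_scale_leq _ _))// size_polyXn.
by rewrite beta_transformD pE beta_transformZXn// subrK.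
Qed.

(** Iterating the recurrence [k] times; the product is the [k]-th moment of the Beta
    distribution. *)
Lemma beta_int_rising a b k : 0 < a -> 0 < b ->
  beta_int (a + k%:R) b =
  (\prod_(i < k) ((a + i%:R) / (a + b + i%:R))) * beta_int a b.
Proof.
move=> a0 b0; elim: k => [|k ih]; first by rewrite addr0 big_ord0 mul1r.
rewrite big_ord_recr/= -natr1 addrA beta_int_recl//; last by rewrite ltr_wpDr.
by rewrite ih mulrCA mulrA [a + k%:R + b]addrAC.
Qed.

Lemma beta_weightMXn a b t k : 0 < t < 1 ->
  beta_weight a b t * t ^+ k = beta_weight (a + k%:R) b t.
Proof.
move=> /andP[t0 t1]; rewrite /beta_weight [a + _ - 1]addrAC.
rewrite (@powRD _ t (a - 1) k%:R) ?(gt_eqF t0)/= ?implybT//.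
by rewrite powR_mulrn ?ltW// mulrAC.
Qed.

Lemma Rintegral_beta_weight_poly a b p m : 0 < a -> 0 < b ->
  (size p <= m)%N ->
  \int[mu]_(t in `]0, 1[) (beta_weight a b t * p.[t]) =
  \sum_(k < m) p`_k * beta_int (a + k%:R) b.
Proof.
move=> a0 b0 pm.
have iW k : mu.-integrable `]0, 1[ (EFin \o beta_weight (a + k%:R) b).
  by apply: integrable_beta_weight => //; rewrite ltr_wpDr.
pose F j t := \sum_(k < j) p`_k * beta_weight (a + k%:R) b t.
have FE j t : F j.+1 t = F j t + p`_j * beta_weight (a + j%:R) b t.
  by rewrite /F big_ord_recr.
have [iF intF] : mu.-integrable `]0, 1[ (EFin \o F m) /\
    \int[mu]_(t in `]0, 1[) F m t = \sum_(k < m) p`_k * beta_int (a + k%:R) b.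
  elim: m {pm} => [|j [ih1 ih2]].
    have -> : F 0%N = cst 0 by apply/funext => t; rewrite /F big_ord0.
    by rewrite big_ord0 Rintegral_cst//= mul0r; split => //; exact: integrable0.
  have -> : F j.+1 = (fun t => F j t + p`_j * beta_weight (a + j%:R) b t).
    by apply/funext => t; rewrite FE.
  have iZ : mu.-integrable `]0, 1[
      (EFin \o (fun t => p`_j * beta_weight (a + j%:R) b t)).
    by apply: (@integrable_finZl _ _ _ mu _ (measurable_itv _)).
  split; first by apply: (@integrable_finD _ _ _ mu _ (measurable_itv _)).
  by rewrite RintegralD// RintegralZl// ih2 big_ord_recr.
rewrite -intF; apply: eq_Rintegral => t; rewrite inE/= in_itv/= => t01.
rewrite (horner_coef_wide _ pm) big_distrr/=; apply: eq_bigr => k _.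
by rewrite mulrCA beta_weightMXn.
Qed.

Lemma genuine_beta_poly n p x : (0 < n)%N -> (size p <= n.+1)%N ->
  genuine_beta n (poly_C01 p) x = (beta_transform n p).[val x].
Proof.
move=> n0 pn; have nR : n%:R != 0 :> R by rewrite pnatr_eq0 -lt0n.
have nk k : (n + k)%:R != 0 :> R by rewrite pnatr_eq0 addn_eq0 negb_and -lt0n n0.
have TE : (beta_transform n p).[val x] = \sum_(k < n.+1) p`_k *
    \prod_(i < k) ((n%:R * val x + i%:R) / (n + i)%:R).
  rewrite /beta_transform horner_sum; apply: eq_bigr => k _.
  by rewrite hornerZ horner_beta_poly.
(* At 0 the factor with [i = 0] kills every nonempty product, leaving the constant coefficient; at 1
   each factor equals [(n + i) / (n + i) = 1]. *)
have [x0|x0] := eqVneq (val x) 0.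
  rewrite TE /genuine_beta x0 eqxx/= restrict_C01E x0.
  rewrite (horner_coef_wide _ pn); apply: eq_bigr => -[[|k] kn] _ /=.
    by rewrite expr0 big_ord0.
  by rewrite expr0n mulr0 big_ord_recl/= mulr0 addr0 mul0r mul0r mulr0.
have [x1|x1] := eqVneq (val x) 1.
  rewrite TE /genuine_beta x1 eqxx orbT restrict_C01E x1.
  rewrite (horner_coef_wide _ pn); apply: eq_bigr => k _ /=.
  by rewrite expr1n big1// => i _; rewrite mulr1 -natrD divff.
have x01 : 0 < val x < 1.
  by have /andP[h1 h2] := val_I01 x; rewrite !lt_def x0 h1 eq_sym x1 h2.
rewrite genuine_betaE//; have /andP[x0' x1'] := x01.
have a0 : 0 < n%:R * val x by rewrite mulr_gt0// ltr0n.
have b0 : 0 < n%:R * (1 - val x) by rewrite mulr_gt0// ?subr_gt0// ltr0n.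
set a := n%:R * val x; set b := n%:R * (1 - val x).
have -> : \int[mu]_(t in `]0, 1[) (beta_weight a b t * valL_ 0 (poly_C01 p) t) =
    \int[mu]_(t in `]0, 1[) (beta_weight a b t * p.[t]).
  apply: eq_Rintegral => t tD.
  have t01 : 0 <= t <= 1.
    by move: tD; rewrite inE/= in_itv/= => /andP[t0 t1]; rewrite !ltW.
  by congr (_ * _); exact: (valL_val (poly_C01 p) (mkI01 t01)).
rewrite (Rintegral_beta_weight_poly a0 b0 pn) TE big_distrr/=.
apply: eq_bigr => k _; rewrite beta_int_rising//.
have B0 : beta_int a b != 0 by rewrite gt_eqF// beta_int_gt0.
(* The parameters sum to [n] whatever [x] is, so the denominators of the moments are constants and
   the result is polynomial in [x]. *)
have -> : a + b = n%:R by rewrite /a /b; ring.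
under [in RHS]eq_bigr do rewrite natrD.
by rewrite mulrC -!mulrA divff// mulr1.
Qed.

End GenuineBetaPolynomials.

(** * The factor [F_n] and its failure to be positive *)

Section BernsteinFactor.
Context {R : realType}.
Implicit Types (f : C01 R) (p q : {poly R}) (x : I01 R) (n k : nat).

Definition bernstein_poly n f : {poly R} := \sum_(k < n.+1)
  (valL_ 0 f (k%:R / n%:R) * 'C(n, k)%:R) *: ('X^k * (1 - 'X) ^+ (n - k)).

Lemma horner_bernstein_poly n f x :
  (bernstein_poly n f).[val x] = bernstein n f x.
Proof.
rewrite /bernstein_poly horner_sum; apply: eq_bigr => k _.
by rewrite !hornerE.
Qed.

Lemma size_bernstein_poly n f : (size (bernstein_poly n f) <= n.+1)%N.
Proof.
apply: (leq_trans (size_sum _ _ _)); apply/bigmax_leqP => k _.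
apply: (leq_trans (size_scale_leq _ _)).
apply: (leq_trans (size_polyMleq _ _)); rewrite size_polyXn addSn /=.
have s1 : size (1 - 'X : {poly R}) = 2%N.
  by rewrite -opprB size_polyN size_XsubC.
have := size_poly_exp_leq (1 - 'X : {poly R}) (n - k).
rewrite s1 mul1n => h; rewrite (leq_trans (leq_add (leqnn k) h))//.
by rewrite addnS subnKC// -ltnS.
Qed.

Lemma bernstein_factor n f : (0 < n)%N -> exists p : {poly R},
  [/\ (size p <= n.+1)%N, beta_transform n p = bernstein_poly n f &
      genuine_beta n (poly_C01 p) = bernstein n f].
Proof.
move=> n0; have [p pn pE] := beta_transform_surj n0 (size_bernstein_poly n f).
exists p; split => //; apply/funext => x.
by rewrite genuine_beta_poly// pE horner_bernstein_poly.
Qed.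

(** The partial inverse is a right inverse at any point of the image of [Pi_ n], and
    [bernstein_factor] places the Bernstein polynomial in that image. *)
Lemma genuine_beta_F n f : (0 < n)%N ->
  genuine_beta n (F_ n f) = bernstein n f.
Proof.
move=> n0; have [p [pn _ pE]] := bernstein_factor f n0.
rewrite /F_ pinvK// inE; exists (poly_C01 p) => //.
by exists p.
Qed.

(* -1/n is a root of the factor n x + 1, which occurs in the image of t^k for
   every k >= 2, so only the constant and the linear coefficient survive. *)
Lemma beta_transform_root n p : (0 < n)%N ->
  (beta_transform n p).[- n%:R^-1] = p`_0 - p`_1 / n%:R.
Proof.
case: n => // n _; have nR : n.+1%:R != 0 :> R by rewrite pnatr_eq0.
rewrite /beta_transform horner_sum big_ord_recl big_ord_recl.
rewrite big1 ?addr0 => [|i _].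
  rewrite !hornerZ !horner_beta_poly big_ord0 mulr1 big_ord_recl big_ord0 /=.
  by rewrite /bump/= !addr0 !addn0 mulr1 mulrN divff// mulN1r mulrN.
rewrite hornerZ horner_beta_poly /= /bump/= !add1n.
by rewrite 2!big_ord_recl/= /bump/= mulrN divff// addNr mul0r mul0r !mulr0.
Qed.

Lemma beta_transform0 n p : (0 < n)%N -> (beta_transform n p).[0] = p`_0.
Proof.
move=> n0; rewrite /beta_transform horner_sum big_ord_recl.
rewrite big1 ?addr0 => [|i _].
  by rewrite hornerZ horner_beta_poly big_ord0 mulr1.
rewrite hornerZ horner_beta_poly /= /bump/= add1n big_ord_recl/=.
by rewrite mulr0 addr0 mul0r mul0r mulr0.
Qed.

Lemma poly_neg_near0 p : p`_0 = 0 -> p`_1 < 0 ->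
  exists2 t : R, 0 < t < 1 & p.[t] < 0.
Proof.
move=> p0 p1; have /factor_theorem[r rE] : root p 0.
  by rewrite rootE horner_coef0 p0.
rewrite subr0 in rE.
have r0 : r.[0] < 0 by rewrite horner_coef0; move: p1; rewrite rE coefMX.
have /cvgrPdist_lt/(_ (- r.[0])) := @continuous_horner R r 0.
rewrite oppr_gt0 => /(_ r0)[d /= d0 hd].
pose t := Num.min (d / 2) (2^-1).
have t0 : 0 < t by rewrite lt_min invr_gt0 ltr0n divr_gt0.
have td : t < d.
  have : t <= d / 2 by rewrite ge_min lexx.
  lra.
have t1 : t < 1.
  have : t <= 2^-1 by rewrite ge_min lexx orbT.
  lra.
exists t; first by rewrite t0.
rewrite rE hornerMX pmulr_llt0//.
have := hd t; rewrite /= sub0r normrN gtr0_norm// => /(_ td).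
rewrite ltr_norml => /andP[h _]; lra.
Qed.

(** The expression [(y + |y|) / 2] is the positive part of [y], so this is a tent with peak 1 at
    [2 / n] that vanishes at all other nodes [k / n]. *)
Definition hat n (t : R) : R :=
  let y := 1 - `|n%:R * t - 2| in (y + `|y|) / 2.

Lemma continuous_hat n : continuous (hat n).
Proof.
move=> t; have cy : (1 - `|n%:R * y - 2|) @[y --> t] --> 1 - `|n%:R * t - 2|.
  apply: cvgB; first exact: cvg_cst.
  apply: cvg_norm; apply: cvgB; last exact: cvg_cst.
  by apply: cvgMr; exact: cvg_id.
by apply: cvgMl; apply: cvgD => //; exact: cvg_norm.
Qed.

Lemma valL_restrict (phi : R -> R) (cphi : continuous phi) (t : R) :
  0 <= t <= 1 -> valL_ 0 (restrict_C01 cphi) t = phi t.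
Proof. by move=> t01; exact: (valL_val (restrict_C01 cphi) (mkI01 t01)). Qed.

Lemma bernstein_poly_hat n : (2 <= n)%N ->
  bernstein_poly n (restrict_C01 (@continuous_hat n)) =
  'C(n, 2)%:R *: ('X^2 * (1 - 'X) ^+ (n - 2)).
Proof.
move=> n2; have n0 : (0 < n)%N by exact: ltn_trans n2.
have nR : 0 < n%:R :> R by rewrite ltr0n.
have hatE k : (k <= n)%N ->
    valL_ 0 (restrict_C01 (@continuous_hat n)) (k%:R / n%:R) = (k == 2%N)%:R.
  move=> kn; rewrite valL_restrict; last first.
    by rewrite divr_ge0//= ler_pdivrMr// mul1r ler_nat.
  rewrite /hat (mulrC n%:R) divfK ?(gt_eqF nR)//.
  have [->|k2] := eqVneq k 2%N.
    by rewrite subrr normr0 subr0 normr1 -mulr2n divff ?pnatr_eq0.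
  rewrite (@ler0_norm _ (1 - _)); first by rewrite subrr mul0r.
  rewrite subr_le0 ler_normr; have [kl|kg|ke] := ltngtP k 2%N.
  - have : k%:R <= 1%:R :> R by rewrite ler_nat.
    by move=> h; apply/orP; right; lra.
  - have : 3%:R <= k%:R :> R by rewrite ler_nat.
    by move=> h; apply/orP; left; lra.
  - by rewrite ke eqxx in k2.
have n2' : (2 < n.+1)%N by [].
rewrite /bernstein_poly (bigD1 (Ordinal n2'))// [valL_ _ _ _](hatE 2%N n2).
rewrite mul1r big1; first exact: addr0.
move=> k k2; rewrite hatE; last by rewrite -ltnS.
have /negbTE -> : (k : nat) != 2%N by apply: contraNneq k2 => k2; exact/eqP/val_inj.
by rewrite mul0r scale0r.
Qed.

Lemma F_not_positive n : (2 <= n)%N -> ~ positive_operator (@F_ R n).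
Proof.
move=> n2 Fpos; have n0 : (0 < n)%N by exact: ltn_trans n2.
pose f := restrict_C01 (@continuous_hat n).
have f0 x : 0 <= f x.
  rewrite restrict_C01E divr_ge0//; set y := (1 - _)%R.
  by have := ler_norm (- y); rewrite normrN; lra.
have [p [pn pT pE]] := bernstein_factor f n0.
(* Both sides have the same image under the Beta operator, so injectivity identifies the abstract
   inverse with a concrete polynomial. *)
have FE : F_ n f = poly_C01 p.
  by apply: (genuine_beta_inj n0); rewrite genuine_beta_F.
have p0 : p`_0 = 0.
  rewrite -(beta_transform0 _ n0) pT bernstein_poly_hat// !hornerE/=.
  by rewrite ?expr0n/= !(mulr0, mul0r).
have nR : 0 < n%:R :> R by rewrite ltr0n.
(* At [-1/n] the factor ['X^2] is a positive square and [1 - 'X] takes the value [1 + 1/n > 0]. *)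
have q0 : 0 < (bernstein_poly n f).[- n%:R^-1].
  rewrite bernstein_poly_hat// hornerZ hornerM hornerXn horner_exp.
  have -> : (1 - 'X : {poly R}).[- n%:R^-1] = 1 + n%:R^-1.
    by rewrite !hornerE opprK.
  rewrite sqrrN mulr_gt0 ?ltr0n ?bin_gt0//.
  by rewrite mulr_gt0 ?exprn_gt0 ?invr_gt0// addr_gt0// invr_gt0.
(* As [p]_0 = 0[, the value at]-1/n[of the transform is]- p[_1 / n], which is positive by [q0]. *)
have p1 : p`_1 < 0.
  move: q0; rewrite -pT beta_transform_root// p0 sub0r oppr_gt0.
  by rewrite pmulr_llt0// invr_gt0.
have [t /andP[t0 t1] pt] := poly_neg_near0 p0 p1.
have t01 : 0 <= t <= 1 by rewrite !ltW.
have := Fpos f f0 (mkI01 t01); rewrite FE restrict_C01E /=.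
by rewrite leNgt pt.
Qed.

End BernsteinFactor.

Unset Implicit Arguments.

Theorem mainTheorem2 (R : realType) (n : nat) (hn : (1 <= n)%N) :
  (forall Q : C01 R -> C01 R,
     (forall f : C01 R, bernstein n f = (genuine_beta n \o Q) f) ->
     Q = @F_ R n) /\
  ((2 <= n)%N ->
     ~ positive_operator (@F_ R n) /\
     ~ (exists Q : C01 R -> C01 R,
          positive_operator Q /\
          @bernstein R n = genuine_beta n \o Q)).
Proof.
(* For each [f], [Q f] and [F_ n f] have the same image [bernstein n f] under the Beta operator.
   Injectivity on all of C[0, 1] is needed, as [Q f] need not be a polynomial a priori. *)
have uniq (Q : C01 R -> C01 R) :
    (forall f, bernstein n f = (genuine_beta n \o Q) f) -> Q = @F_ R n.
  move=> QE; apply/funext => f; apply: (genuine_beta_inj hn).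
  by rewrite genuine_beta_F// QE.
split => // n2; split; first exact: F_not_positive.
move=> [Q [Qpos QE]]; have QF : Q = @F_ R n by apply: uniq => f; rewrite QE.
by rewrite QF in Qpos; exact: (F_not_positive n2 Qpos).
Qed.
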